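(* Let $\psi: T \to \mathbb{C}$ be a function for which $M_\psi$ is bounded on $L_\mu^\infty$ (respectively $L_\mu^0$). Then $M_\psi$ is bounded below on $L_\mu^\infty$ (respectively $L_\mu^0$) if and only if $\inf_{v \in T} |\psi(v)| > 0$.
   Context: $(T,\mathrm{d})$ is a metric space with a distinguished point $o$ (the root); the length of $v \in T$ is $|v| = \mathrm{d}(o,v)$. $T$ is assumed locally finite (for every $M>0$ the set $\{v \in T : |v| < M\}$ is finite) and unbounded (for every $M>0$ there is $v \in T$ with $|v| \ge M$). $\mu: T \to (0,\infty)$ is an arbitrary positive function (a weight). $L_\mu^\infty$ is the Banach space of functions $f: T \to \mathbb{C}$ with $\|f\|_\mu = \sup_{v \in T} \mu(v)|f(v)| < \infty$, and $L_\mu^0$ is its closed subspace of those $f$ with $\lim_{|v|\to\infty} \mu(v)|f(v)| = 0$. The multiplication operator is the linear map $M_\psi f = \psi f$; it is bounded on a space if it is a bounded operator from that space to itself. A bounded operator $A: X \to Y$ between Banach spaces is bounded below if there is $\delta > 0$ with $\|Ax\|_Y \ge \delta \|x\|_X$ for all $x \in X$. *)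

(* Defs.v *)
From HB Require Import structures.
From mathcomp Require Import all_boot all_order all_algebra.
From mathcomp Require Import all_classical all_reals all_analysis.
From mathcomp Require Import complex.

Set Implicit Arguments.
Unset Strict Implicit.
Unset Printing Implicit Defensive.

Import Order.TTheory GRing.Theory Num.Theory.
Import numFieldNormedType.Exports.
Import Normc.

Local Open Scope classical_set_scope.
Local Open Scope ring_scope.
Local Open Scope complex_scope.

Section bounded_operators.
Context {K : numFieldType} {X Y : normedModType K}.

Definition bounded_operator (A : {linear X -> Y}) : Prop :=
  exists M : K, forall x, `|A x| <= M * `|x|.

(* For K = R[i], 0 < delta means that delta is a positive real: the order of
   R[i] only compares numbers with the same imaginary part. *)
Definition bounded_below (A : {linear X -> Y}) : Prop :=
  exists2 delta : K, 0 < delta & forall x, delta * `|x| <= `|A x|.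

End bounded_operators.

Section rooted_metric_space.
Context {R : realType} {T : metricType R}.
Variable o : T.

Definition len (v : T) : R := mdist o v.

Definition locally_finite : Prop :=
  forall M : R, 0 < M -> finite_set [set v | len v < M].

Definition unbounded : Prop :=
  forall M : R, 0 < M -> exists v, M <= len v.

(* the filter |v| -> oo *)
Definition at_infinity : set_system T :=
  filter_from [set: R] (fun M => [set v | M <= len v]).

End rooted_metric_space.

Section weighted_Linf.
Context {R : realType} {T : Type}.
Variable mu : T -> {posnum R}.
Implicit Types f g : T -> R[i].

(* [normc] is the modulus R[i] -> R; the library's `|z| takes its values
   in R[i] *)
Definition weighted_mod f (v : T) : R := (mu v)%:num * normc (f v).

Definition Linf_pred : {pred T -> R[i]} :=
  [pred f | `[< has_ubound (range (weighted_mod f)) >]].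

Record Linf := MkLinf {
  Linf_fun :> T -> R[i] ;
  _ : Linf_fun \in Linf_pred }.

HB.instance Definition _ := [isSub for Linf_fun].
HB.instance Definition _ := [Choice of Linf by <:].

Lemma normc_ge0 (z : R[i]) : 0 <= normc z.
Proof. by case: z => a b; exact: sqrtr_ge0. Qed.

Lemma weighted_mod_ge0 f v : 0 <= weighted_mod f v.
Proof. by rewrite mulr_ge0// normc_ge0. Qed.

Lemma weighted_modD f g v :
  weighted_mod (f + g) v <= weighted_mod f v + weighted_mod g v.
Proof. by rewrite /weighted_mod -mulrDr ler_wpM2l// le_normcD. Qed.

Lemma weighted_modZ (a : R[i]) f v :
  weighted_mod (a *: f) v = normc a * weighted_mod f v.
Proof. by rewrite /weighted_mod mulrCA -normcM. Qed.

Lemma Linf_predP f :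
  reflect (exists M, forall v, weighted_mod f v <= M) (f \in Linf_pred).
Proof.
apply: (iffP (asboolP _)) => -[M fM]; exists M.
  by move=> v; apply: fM; exists v.
by move=> _ [v _ <-].
Qed.

Lemma Linf_submod_closed : submod_closed Linf_pred.
Proof.
split.
  apply/Linf_predP; exists 0 => v.
  by rewrite /weighted_mod normc0 mulr0.
move=> a f g /Linf_predP[M fM] /Linf_predP[N gN].
apply/Linf_predP; exists (normc a * M + N) => v.
rewrite (le_trans (weighted_modD _ _ _))// lerD// weighted_modZ.
by rewrite ler_wpM2l// normc_ge0.
Qed.

HB.instance Definition _ :=
  GRing.isSubmodClosed.Build _ _ Linf_pred Linf_submod_closed.
HB.instance Definition _ := [SubChoice_isSubLmodule of Linf by <:].

Definition Linf_norm (f : Linf) : R := sup (range (weighted_mod f)).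

Lemma weighted_mod_le_norm (f : Linf) v : weighted_mod f v <= Linf_norm f.
Proof.
apply: ub_le_sup; last by exists v.
by case: f => f /= /asboolP.
Qed.

Lemma Linf_norm_ge0 (f : Linf) : 0 <= Linf_norm f.
Proof.
have [e|/set0P[_ [v _ _]]] := eqVneq (range (weighted_mod f)) set0.
  by rewrite /Linf_norm e sup0.
by rewrite (le_trans (weighted_mod_ge0 f v))// weighted_mod_le_norm.
Qed.

Lemma Linf_norm_le (f : Linf) (M : R) :
  0 <= M -> (forall v, weighted_mod f v <= M) -> Linf_norm f <= M.
Proof.
move=> M0 fM; rewrite /Linf_norm.
have [->|/set0P ne] := eqVneq (range (weighted_mod f)) set0.
  by rewrite sup0.
by apply: ge_sup => // _ [v _ <-].
Qed.

Lemma Linf_normD (f g : Linf) :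
  (Linf_norm (f + g))%:C <= (Linf_norm f)%:C + (Linf_norm g)%:C :> R[i].
Proof.
rewrite -rmorphD lecR Linf_norm_le ?addr_ge0 ?Linf_norm_ge0// => v.
rewrite (le_trans (weighted_modD _ _ _))//.
by rewrite lerD ?weighted_mod_le_norm.
Qed.

Lemma Linf_normZ (a : R[i]) (f : Linf) :
  (Linf_norm (a *: f))%:C = `|a| * (Linf_norm f)%:C.
Proof.
have le b (g : Linf) : Linf_norm (b *: g) <= normc b * Linf_norm g.
  rewrite Linf_norm_le ?mulr_ge0 ?normc_ge0 ?Linf_norm_ge0// => v.
  by rewrite weighted_modZ ler_wpM2l ?normc_ge0 ?weighted_mod_le_norm.
rewrite -[`|a|]/((normc a)%:C) -rmorphM; congr (_%:C).
apply/eqP; rewrite eq_le le/=.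
have [->|a0] := eqVneq a 0; first by rewrite normc0 mul0r Linf_norm_ge0.
have na0 : 0 < normc a.
  by rewrite lt_neqAle normc_ge0 eq_sym andbT; apply: contra_neq a0 => /eq0_normc.
rewrite -ler_pdivlMl// -normcV.
by rewrite -{1}[f](scalerK a0).
Qed.

Lemma Linf_norm0_eq0 (f : Linf) : (Linf_norm f)%:C = 0 :> R[i] -> f = 0.
Proof.
move=> /(congr1 (@complex.Re R)) /= f0.
apply/val_inj/funext => v /=; apply: eq0_normc.
have := weighted_mod_le_norm f v; rewrite f0 => fv0.
have /eqP : weighted_mod f v = 0.
  by apply/eqP; rewrite eq_le fv0 weighted_mod_ge0.
by rewrite mulf_eq0 gt_eqF//= => /eqP.
Qed.

HB.instance Definition _ := Lmodule_isNormed.Build R[i] Linf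
  Linf_normD Linf_normZ Linf_norm0_eq0.

End weighted_Linf.
Arguments Linf {R T} mu.

Section weighted_L0.
Context {R : realType} {T : metricType R}.
Variables (o : T) (mu : T -> {posnum R}).

Definition L0_pred : {pred Linf mu} :=
  [pred f : Linf mu | `[< weighted_mod mu f @ at_infinity o --> (0 : R) >]].

Record L0 := MkL0 {
  L0_Linf :> Linf mu ;
  _ : L0_Linf \in L0_pred }.

HB.instance Definition _ := [isSub for L0_Linf].
HB.instance Definition _ := [Choice of L0 by <:].

Lemma at_infinity_filter : Filter (at_infinity o).
Proof.
apply: filter_from_filter; first by exists 0.
move=> M N _ _; exists (Num.max M N) => // v /=.
by rewrite ge_max => /andP[].
Qed.

Lemma L0_submod_closed : submod_closed L0_pred.
Proof.
have F := at_infinity_filter.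
split.
  apply/asboolP.
  rewrite (_ : weighted_mod mu _ = cst 0); first exact: cvg_cst.
  by apply/funext => v; rewrite /weighted_mod normc0 mulr0.
move=> a f g /asboolP f0 /asboolP g0; apply/asboolP.
apply: (@squeeze_cvgr _ _ _ _ (cst 0)
  (fun v => normc a * weighted_mod mu f v + weighted_mod mu g v)).
- apply: nearW => v; rewrite weighted_mod_ge0/=.
  by rewrite (le_trans (weighted_modD _ _ _ _))// lerD// weighted_modZ.
- exact: cvg_cst.
- rewrite -[X in _ --> X]addr0; apply: cvgD => //.
  rewrite -[X in _ --> X](mulr0 (normc a)).
  exact: cvgMr.
Qed.

HB.instance Definition _ :=
  GRing.isSubmodClosed.Build _ _ L0_pred L0_submod_closed.
HB.instance Definition _ := [SubChoice_isSubLmodule of L0 by <:].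

Definition L0_norm (f : L0) : R[i] := `|L0_Linf f|.

Lemma L0_normD (f g : L0) : L0_norm (f + g) <= L0_norm f + L0_norm g.
Proof. exact: ler_normD. Qed.

Lemma L0_normZ (a : R[i]) (f : L0) : L0_norm (a *: f) = `|a| * L0_norm f.
Proof. exact: normrZ. Qed.

Lemma L0_norm0_eq0 (f : L0) : L0_norm f = 0 -> f = 0.
Proof. by move=> /normr0_eq0 f0; exact: val_inj. Qed.

HB.instance Definition _ := Lmodule_isNormed.Build R[i] L0
  L0_normD L0_normZ L0_norm0_eq0.

End weighted_L0.
Arguments L0 {R T} o mu.

Definition mult_op {R : realType} {T : Type} (psi f : T -> R[i]) : T -> R[i] :=
  fun v => psi v * f v.

(* Main.v *)
(** For each [v], the indicator function of [v] has norm [mu v], and [M_psi]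
multiplies it by [psi v]; so a lower bound for [M_psi] on the indicators is a
lower bound for [|psi|].  These functions vanish at infinity, which is why the
same argument covers both spaces.  Conversely, a lower bound for [|psi|] passes
pointwise to the suprema. *)
Require Import Defs.
From mathcomp Require Import all_boot all_order all_algebra.
From mathcomp Require Import all_classical all_reals all_analysis.
From mathcomp Require Import complex.
Import Order.TTheory GRing.Theory Num.Theory.
Import numFieldNormedType.Exports.
Local Open Scope classical_set_scope.
Local Open Scope ring_scope.

Section pointwise.
Context {R : realType} {T : eqType} (mu : T -> {posnum R}).

Definition indicator (v : T) : T -> R[i] := fun u => (u == v)%:R.

Lemma weighted_mod_mult_op (psi f : T -> R[i]) v :
  weighted_mod mu (mult_op psi f) v = Normc.normc (psi v) * weighted_mod mu f v.
Proof. by rewrite /weighted_mod /mult_op Normc.normcM mulrCA. Qed.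

Lemma weighted_mod_indicator (v u : T) :
  weighted_mod mu (indicator v) u = (mu v)%:num * (u == v)%:R.
Proof.
rewrite /weighted_mod /indicator.
by have [->|_] := eqVneq u v; rewrite ?Normc.normc1 ?Normc.normc0 ?mulr0.
Qed.

Lemma indicator_Linf (v : T) : indicator v \in Linf_pred mu.
Proof.
apply/Linf_predP; exists (mu v)%:num => u.
by rewrite weighted_mod_indicator ler_piMr// lern1 leq_b1.
Qed.

(** The supremum is attained at [v]. The form with an arbitrary [f] fits [j f], which is known only
    through its values. *)
Lemma Linf_norm_indicator (f : Linf mu) v :
  (f : T -> R[i]) = indicator v -> Linf_norm f = (mu v)%:num.
Proof.
move=> fv; apply/eqP; rewrite eq_le; apply/andP; split.
  apply: Linf_norm_le => // u.
  by rewrite fv weighted_mod_indicator ler_piMr// lern1 leq_b1.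
have := weighted_mod_le_norm f v.
by rewrite fv weighted_mod_indicator eqxx mulr1.
Qed.

(* [j] stands for the identity of [Linf mu] or the inclusion of [L0 o mu]. *)
Lemma mult_op_bounded_below (X : normedModType R[i]) (j : X -> Linf mu)
    (psi : T -> R[i]) (A : {linear X -> X}) (o : T) :
  (forall f, `|f| = `|j f|) ->
  (forall v, exists f, (j f : T -> R[i]) = indicator v) ->
  (forall f, (j (A f) : T -> R[i]) = mult_op psi (j f)) ->
  bounded_below A <-> 0 < inf (range (fun v : T => Normc.normc (psi v))).
Proof.
move=> jE jind AE.
have normE f : `|f| = (Linf_norm (j f))%:C%C by rewrite jE.
split=> [[[d b]]|].
  (* Positivity in [R[i]] forces the imaginary part [b] to vanish, leaving a real constant [d]. *)
  rewrite ltcE /= => /andP[/eqP -> d0] dA.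
  apply: (lt_le_trans d0); apply: lb_le_inf.
    (* The root makes the range nonempty, so its [inf] is not a default value. *)
    by exists (Normc.normc (psi o)), o.
  move=> _ [v _ <-]; have [f fv] := jind v.
  have := dA f; rewrite !normE -[(d +i* 0)%C]/(d%:C%C) -rmorphM lecR.
  rewrite (Linf_norm_indicator _ _ fv) => h.
  (* After scaling by [mu v], it remains to bound the norm of the image of the indicator, which
     lives at [v] only. *)
  rewrite -(ler_pM2r (x := (mu v)%:num))//; apply: (le_trans h).
  apply: Linf_norm_le => [|u]; first by rewrite mulr_ge0 ?normc_ge0.
  rewrite AE weighted_mod_mult_op fv weighted_mod_indicator.
  have [->|_] := eqVneq u v; first by rewrite mulr1.
  by rewrite !mulr0 mulr_ge0 ?normc_ge0.
set c := inf _ => c0; exists c%:C%C; first by rewrite ltcR.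
have c_le v : c <= Normc.normc (psi v).
  by apply: ge_inf; [exists 0 => _ [u _ <-]; exact: normc_ge0 | exists v].
(* Moving [c] to the right isolates the norm of [j f], a supremum that can be bounded pointwise. *)
move=> f; rewrite !normE -rmorphM lecR -ler_pdivlMl//.
apply: Linf_norm_le => [|v].
  by rewrite mulr_ge0 ?Linf_norm_ge0// invr_ge0 ltW.
rewrite ler_pdivlMl//; apply: le_trans (weighted_mod_le_norm _ v).
by rewrite AE weighted_mod_mult_op ler_wpM2r ?weighted_mod_ge0.
Qed.

End pointwise.

Lemma indicator_L0 {R : realType} {T : metricType R} (o : T)
    (mu : T -> {posnum R}) (v : T) :
  MkLinf (indicator_Linf mu v) \in L0_pred o (mu := mu).
Proof.
have F := at_infinity_filter o.
(* The [+ 1] excludes [v] itself, as neighbourhoods of infinity are given by a non-strict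
   inequality. *)
apply/asboolP; apply: cvg_near_cst; exists (len o v + 1) => // u /= vu.
rewrite weighted_mod_indicator; case: eqP => [uv|_]; last by rewrite mulr0.
by move: vu; rewrite uv gerDl ler10.
Qed.

Theorem corollary5p8 (R : realType) (T : metricType R) (o : T)
    (T_locally_finite : locally_finite o) (T_unbounded : unbounded o)
    (mu : T -> {posnum R}) (psi : T -> R[i]) :
  (forall A : {linear Linf mu -> Linf mu},
     (forall f : Linf mu, (A f : T -> R[i]) = mult_op psi f) ->
     bounded_operator A ->
     (bounded_below A <-> 0 < inf (range (fun v : T => Normc.normc (psi v)))))
  /\
  (forall A : {linear L0 o mu -> L0 o mu},
     (forall f : L0 o mu, (A f : T -> R[i]) = mult_op psi f) ->
     bounded_operator A ->
     (bounded_below A <-> 0 < inf (range (fun v : T => Normc.normc (psi v))))).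
Proof.
split=> A AE _.
  apply: (mult_op_bounded_below mu _ id psi A o _ _ AE) => // v.
  by exists (MkLinf (indicator_Linf mu v)).
apply: (mult_op_bounded_below mu _ (@L0_Linf _ _ o mu) psi A o _ _ AE) => // v.
by exists (MkL0 (indicator_L0 o mu v)).
Qed.
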